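(* For every integer $n\geq 2$, the Gutman index of the pentagonal cylinder chain $P_n$ is \[\operatorname{Gut}(P_n)=\begin{cases}49n^3+64n^2+5n, & n \text{ even},\\ 49n^3+64n^2+4n, & n \text{ odd}.\end{cases}\]
   Context: For $n\geq 2$, $P_n$ has vertex set $\{u_1,\dots,u_{2n}\}\cup\{u'_1,\dots,u'_{2n}\}\cup\{w_1,\dots,w_n\}$ and edges $u_ku_{k+1}$, $u'_ku'_{k+1}$ ($1\le k\le 2n-1$), $u_{2n}u_1$, $u'_{2n}u'_1$, $u_{2k-1}u'_{2k-1}$ ($1\le k\le n$), and $u_{2k}w_k$, $w_ku'_{2k}$ ($1\le k\le n$). For a connected graph with vertices $v_1,\dots,v_N$, degrees $d_i$ and shortest-path distances $d_{ij}$, the Gutman index is $\operatorname{Gut}(G)=\frac12\sum_{i=1}^N\sum_{j=1}^N d_id_jd_{ij}$. *)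

(* Defs.v *)
From mathcomp Require Import all_boot all_order all_algebra.
From mathcomp Require Import zify.

Set Implicit Arguments.
Unset Strict Implicit.
Unset Printing Implicit Defensive.

Record sgraph := SGraph {
  vertex :> finType;
  edge : rel vertex;
  edge_sym : symmetric edge;
  edge_irr : irreflexive edge }.

Definition connected (G : sgraph) := forall x y : G, connect (@edge G) x y.

Definition deg (G : sgraph) (x : G) : nat := #|[set y | edge x y]|.

Definition walk_of_length (G : sgraph) (x y : G) (k : nat) : bool :=
  [exists p : k.-tuple G, path (@edge G) x p && (last x p == y)].

(* Searching k < #|G| suffices, as shortest walks do not repeat vertices (see
   [gdistP]); the value is #|G| when x and y are in different components. *)
Definition gdist (G : sgraph) (x y : G) : nat :=
  find (walk_of_length x y) (iota 0 #|G|).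

Definition gutman (G : sgraph) : rat :=
  (2^-1 * \sum_(x : G) \sum_(y : G) (deg x * deg y * gdist x y)%N%:R)%R.

Lemma gdistP (G : sgraph) (x y : G) : connect (@edge G) x y ->
  (exists p, [/\ path (@edge G) x p, last x p = y & size p = gdist x y]) /\
  (forall p, path (@edge G) x p -> last x p = y -> gdist x y <= size p).
Proof.
have short p : path (@edge G) x p -> last x p = y ->
    exists2 k, k <= size p & (k < #|G|) && walk_of_length x y k.
  case/shortenP=> q xq uq sub <-.
  exists (size q); first exact/uniq_leq_size/sub/(andP uq).2.
  apply/andP; split; last first.
    by apply/existsP; exists (in_tuple q); rewrite /= xq eqxx.
  by have := max_card (mem (x :: q)); rewrite (card_uniqP uq).
have lefind k : k < #|G| -> walk_of_length x y k -> gdist x y <= k.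
  move=> kG wk; rewrite leqNgt; apply/negP => lt.
  by have := before_find 0 lt; rewrite nth_iota // add0n wk.
case/connectP=> p xp lp; have [k _ /andP[kG wk]] := short p xp (esym lp).
split=> [|q xq lq]; last first.
  have [j jq /andP[jG wj]] := short q xq lq.
  exact: leq_trans (lefind j jG wj) jq.
have fG : gdist x y < #|G| := leq_ltn_trans (lefind k kG wk) kG.
have : has (walk_of_length x y) (iota 0 #|G|) by rewrite has_find size_iota.
move=> /(nth_find 0); rewrite nth_iota // add0n.
by case/existsP=> t /andP[xt /eqP lt]; exists t; rewrite size_tuple.
Qed.

(* inl (inl i), inl (inr i) and inr k stand for u_(i+1), u'_(i+1), w_(k+1). *)
Definition pent_vertex (n : nat) : finType :=
  (('I_(2 * n) + 'I_(2 * n)) + 'I_n)%type.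

Definition cycle_arc (m : nat) (i j : 'I_m) : bool :=
  (i.+1 == j) || ((i.+1 == m) && (j.+1 == 1)).

(* In one-based indices a = i.+1, b = k.+1 the u_a u'_a edges are those with a
   odd, and u_a w_b, w_b u'_a are edges when a = 2b. *)
Definition pent_arc (n : nat) (x y : pent_vertex n) : bool :=
  match x, y with
  | inl (inl i), inl (inl j) => cycle_arc i j
  | inl (inr i), inl (inr j) => cycle_arc i j
  | inl (inl i), inl (inr j) => (i == j) && odd i.+1
  | inl (inl i), inr k => i.+1 == 2 * k.+1
  | inr k, inl (inr i) => i.+1 == 2 * k.+1
  | _, _ => false
  end.

Definition pent_edge (n : nat) : rel (pent_vertex n) :=
  fun x y => pent_arc x y || pent_arc y x.

Lemma pent_edge_sym n : symmetric (@pent_edge n).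
Proof. by move=> x y; rewrite /pent_edge orbC. Qed.

Lemma pent_edge_irr n : irreflexive (@pent_edge n).
Proof. by case=> [[]|] i; rewrite /pent_edge /= ?orbb // /cycle_arc; lia. Qed.

Definition pentagonal_cylinder (n : nat) : sgraph :=
  SGraph (@pent_edge_sym n) (@pent_edge_irr n).

Lemma pentagonal_cylinder_connected n : connected (pentagonal_cylinder n).
Proof.
case: n => [|n]; first by case=> [[]|] [].
have cs : connect_sym (@pent_edge n.+1) := sym_connect_sym (@pent_edge_sym _).
have l0 : 0 < 2 * n.+1 by [].
pose o : pent_vertex n.+1 := inl (inl (Ordinal l0)).
have cu m (h : m < 2 * n.+1) :
    connect (@pent_edge n.+1) o (inl (inl (Ordinal h))).
  elim: m h => [|m IH] h.
    by apply: eq_connect0; congr (inl (inl _)); apply: val_inj.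
  apply: connect_trans (IH (ltnW h)) (connect1 _).
  by rewrite /pent_edge /= /cycle_arc /= eqxx.
have cu' m (h : m < 2 * n.+1) :
    connect (@pent_edge n.+1) o (inl (inr (Ordinal h))).
  elim: m h => [|m IH] h.
    by apply: connect1.
  apply: connect_trans (IH (ltnW h)) (connect1 _).
  by rewrite /pent_edge /= /cycle_arc /= eqxx.
have co x : connect (@pent_edge n.+1) o x.
  case: x => [[[m h]|[m h]]|k] //.
  have h : (2 * k.+1).-1 < 2 * n.+1 by have := ltn_ord k; lia.
  apply: connect_trans (cu _ h) (connect1 _).
  by rewrite /pent_edge /=; lia.
by move=> x y; apply: connect_trans (co y); rewrite /= cs.
Qed.

(* Main.v *)
(* Place w_k at position 2k of the cycle, next to u_(2k) and u'_(2k).  Of two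
   consecutive cycle positions one carries an edge u u', so the distance of two
   vertices is the cyclic distance of their positions plus a correction that
   depends only on their types (0 for u u, 1 for u u' and for w u, 2 for w w),
   except for the pairs u_a, u'_a with a even, at distance 2, and w_k, w_k.  This
   holds because the formula vanishes exactly on the diagonal, changes by at most
   one along an edge, and drops by one along some edge towards the target.
   Cyclic distances from a fixed position sum to n^2 over all positions, and
   from an even position to 2 * floor(n^2/4) over the even ones, so the double sum
   splits by vertex type into 96 n^3 + 128 n^2 + 10 n + 8 n floor(n^2/4). *)

Require Import Defs.
From mathcomp Require Import all_boot all_order all_algebra.
From mathcomp Require Import zify ring.

Set Implicit Arguments.
Unset Strict Implicit.
Unset Printing Implicit Defensive.

(** * General tools for distances and degrees *)

(** The descent condition builds a walk of length [f x] from [x] to [y]; the Lipschitz condition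
    shows that no walk to [y] is shorter. *)
Lemma gdist_potential (G : sgraph) (y : G) (f : G -> nat) :
  f y = 0 ->
  (forall x z, edge x z -> f x <= (f z).+1) ->
  (forall x, x != y -> exists2 z, edge x z & f x = (f z).+1) ->
  forall x, gdist x y = f x.
Proof.
move=> fy lip desc x.
have [p [xp lp sp]] :
    exists p, [/\ path (@edge G) x p, last x p = y & size p = f x].
  have [k] := ubnP (f x); elim: k x => // k IH x /ltnSE xk.
  have [->|/desc[z xz fxz]] := eqVneq x y; first by exists [::]; rewrite fy.
  have [|p [zp lp sp]] := IH z; first by rewrite -fxz.
  by exists (z :: p); rewrite /= xz zp lp sp fxz.
have lower q : path (@edge G) x q -> last x q = y -> f x <= size q.
  elim: q x {p xp lp sp} => [|z q IH] x /= => [_ -> | /andP[xz zq] lq].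
    by rewrite fy.
  by apply: leq_trans (lip _ _ xz) _; rewrite ltnS IH.
have cxy : connect (@edge G) x y by apply/connectP; exists p.
have [[q [xq lq sq]] minp] := gdistP cxy.
by apply/eqP; rewrite eqn_leq -{2}sq lower // andbT -sp minp.
Qed.

Lemma deg_uniq_seq (G : sgraph) (x : G) (s : seq G) :
  uniq s -> (forall y, edge x y = (y \in s)) -> deg x = size s.
Proof.
by move=> /card_uniqP <- xs; apply: eq_card => y; rewrite inE xs.
Qed.

(** * Distances in a cycle *)

(** One of the two truncated differences is 0, so their sum is |i - j|. *)
Definition cycle_dist (m i j : nat) : nat :=
  minn ((i - j) + (j - i)) (m - ((i - j) + (j - i))).

(** Step along the shorter arc. In an even cycle every step, even across the wrap-around, flips
    parity; this will kill the exceptional term of [pent_dist] after a step from an odd index. *)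
Lemma cycle_dist_step m (i j : 'I_m) : i != j -> exists k : 'I_m,
  [/\ cycle_arc i k || cycle_arc k i,
      cycle_dist m i j = (cycle_dist m k j).+1 & ~~ odd m -> odd k = ~~ odd i].
Proof.
move=> neq; have {neq} : (i : nat) <> j by move/val_inj/eqP; rewrite (negPf neq).
case: i j => [i im] [j jm] /= neq; rewrite /cycle_arc /=.
have sm : (if i.+1 == m then 0 else i.+1) < m by case: ifP; lia.
have pm : (if i == 0 then m.-1 else i.-1) < m by case: ifP; lia.
have dist_le a b : a <= b -> cycle_dist m a b = minn (b - a) (m - (b - a)).
  by move=> ab; rewrite /cycle_dist (eqP ab).
have dist_ge a b : b <= a -> cycle_dist m a b = minn (a - b) (m - (a - b)).
  by move=> ab; rewrite /cycle_dist (eqP ab) addn0.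
have [ij|ji] : i < j \/ j < i by lia.
  have [near|far] := leqP (2 * (j - i)) m.
    exists (Ordinal sm); split=> /=; [by case: ifP; lia| |by case: ifP; lia].
    by rewrite dist_le 1?ltnW //; case: ifP => ?; [lia | rewrite dist_le; lia].
  exists (Ordinal pm); split=> /=; [by case: ifP; lia| |by case: ifP; lia].
  by rewrite dist_le 1?ltnW //; case: ifP => ?; [rewrite dist_ge; lia | rewrite dist_le; lia].
have [far|near] := leqP m (2 * (i - j)).
  exists (Ordinal sm); split=> /=; [by case: ifP; lia| |by case: ifP; lia].
  by rewrite dist_ge 1?ltnW //; case: ifP => ?; [rewrite dist_le; lia | rewrite dist_ge; lia].
exists (Ordinal pm); split=> /=; [by case: ifP; lia| |by case: ifP; lia].
by rewrite dist_ge 1?ltnW //; case: ifP => ?; [lia | rewrite dist_ge; lia].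
Qed.

(** Rotating the cycle reduces the claim to [i] = 0. *)
Lemma cycle_dist_sum m i : i < m ->
  \sum_(j < m) cycle_dist m i j = (m ^ 2) %/ 4.
Proof.
case: m => // m; elim: i => [_|i IH im]; last first.
  rewrite -(IH (ltnW im)) big_ord_recl [RHS]big_ord_recr addnC.
  by congr addn; rewrite /cycle_dist /=; lia.
(* Pass from [m] to [m.+2]: position [j.+1] of the longer cycle is one farther from 0 than position
   [j] of the shorter, and the last position adds 1. *)
move: m.+1 => {m}; elim/ltn_ind=> -[|[|m]] IH.
- by rewrite big_ord0.
- by rewrite big_ord1.
have -> : (m.+2 ^ 2) %/ 4 = (m ^ 2) %/ 4 + \sum_(j < m) 1 + 1.
  by rewrite sum1_card card_ord; lia.
rewrite -IH // big_ord_recl big_ord_recr /= addnA; congr (_ + _).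
  rewrite -big_split /=; apply: eq_bigr => j _.
  by have := ltn_ord j; rewrite /cycle_dist /= /bump /=; lia.
by rewrite /cycle_dist /= /bump /=; lia.
Qed.

Lemma cycle_dist_double n k l :
  cycle_dist (2 * n) (2 * k).+1 (2 * l).+1 = 2 * cycle_dist n k l.
Proof. by rewrite /cycle_dist; lia. Qed.

(** * Distances in the pentagonal cylinder *)

(* Indices are zero-based: i odd is position a = i.+1 even, and w_(k+1) lies at
   the zero-based position (2 * k).+1. *)
Definition pent_dist (n : nat) (x y : pent_vertex n) : nat :=
  match x, y with
  | inl (inl i), inl (inl j) | inl (inr i), inl (inr j) => cycle_dist (2 * n) i j
  | inl (inl i), inl (inr j) | inl (inr i), inl (inl j) =>
    cycle_dist (2 * n) i j + 1 + ((i == j) && odd i)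
  | inr k, inl (inl j) | inr k, inl (inr j) => cycle_dist (2 * n) (2 * k).+1 j + 1
  | inl (inl i), inr l | inl (inr i), inr l => cycle_dist (2 * n) i (2 * l).+1 + 1
  | inr k, inr l => cycle_dist (2 * n) (2 * k).+1 (2 * l).+1 + 2 * (k != l)
  end.

(** An edge u u' occurs only at an even zero-based index, where the exceptional term is 0, so
    crossing it changes the value by at most one. *)
Lemma pent_dist_lip n (x y z : pent_vertex n) :
  pent_edge x z -> pent_dist x y <= (pent_dist z y).+1.
Proof.
by case: x y z => [[]|] [x xn] [[]|] [y yn] [[]|] [z zn];
  rewrite /pent_edge /= /cycle_arc /= -?val_eqE /= /cycle_dist; lia.
Qed.

(** Towards the opposite cycle, cross at once from an even index; from an odd one, first step along
    the cycle, or go through w if the target is directly opposite. Towards some w, follow the cycle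
    to its position. From w, move to the cycle of the target, or to the u cycle if the target is
    another w. *)
Lemma pent_dist_descent n (x y : pent_vertex n) : x != y ->
  exists2 z, pent_edge x z & pent_dist x y = (pent_dist z y).+1.
Proof.
have n2 : ~~ odd (2 * n) by rewrite oddM.
have odd_spoke (k : 'I_n) : (2 * k).+1 < 2 * n by have := ltn_ord k; lia.
have odd_index (i : 'I_(2 * n)) : odd i -> exists k : 'I_n, i = Ordinal (odd_spoke k).
  move=> oi; have k_lt : i./2 < n by have := ltn_ord i; lia.
  by exists (Ordinal k_lt); apply: val_inj => /=; lia.
case: x y => [[]|] x [[]|] y xy.
- have {}xy : x != y by apply: contraNneq xy => ->.
  have [k [xk dk _]] := cycle_dist_step xy.
  by exists (inl (inl k)).
- have [oi|ei] := boolP (odd x); last first.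
    exists (inl (inr x)); first by rewrite /pent_edge /= eqxx ei.
    by rewrite /= (negPf ei) andbF addn0 addn1.
  have [xy'|xy'] := eqVneq x y; last first.
    have [k [xk dk pk]] := cycle_dist_step xy'.
    exists (inl (inl k)) => //=.
    by rewrite dk pk // oi (negPf xy') andbF.
  have [k xE] := odd_index _ oi.
  exists (inr k); first by rewrite /pent_edge xE /=; lia.
  by rewrite -xy' xE /= eqxx /cycle_dist /=; lia.
- have [xy'|xy'] := eqVneq x (Ordinal (odd_spoke y)).
    exists (inr y); first by rewrite /pent_edge xy' /=; lia.
    by rewrite xy' /= eqxx /cycle_dist /=; lia.
  have [k [xk dk _]] := cycle_dist_step xy'.
  by exists (inl (inl k)) => //=; rewrite dk.
- have [oi|ei] := boolP (odd x); last first.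
    exists (inl (inl x)); first by rewrite /pent_edge /= eqxx ei.
    by rewrite /= (negPf ei) andbF addn0 addn1.
  have [xy'|xy'] := eqVneq x y; last first.
    have [k [xk dk pk]] := cycle_dist_step xy'.
    exists (inl (inr k)) => //=.
    by rewrite dk pk // oi (negPf xy') andbF.
  have [k xE] := odd_index _ oi.
  exists (inr k); first by rewrite /pent_edge xE /=; lia.
  by rewrite -xy' xE /= eqxx /cycle_dist /=; lia.
- have {}xy : x != y by apply: contraNneq xy => ->.
  have [k [xk dk _]] := cycle_dist_step xy.
  by exists (inl (inr k)).
- have [xy'|xy'] := eqVneq x (Ordinal (odd_spoke y)).
    exists (inr y); first by rewrite /pent_edge xy' /=; lia.
    by rewrite xy' /= eqxx /cycle_dist /=; lia.
  have [k [xk dk _]] := cycle_dist_step xy'.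
  by exists (inl (inr k)) => //=; rewrite dk.
- exists (inl (inl (Ordinal (odd_spoke x)))); first by rewrite /pent_edge /=; lia.
  by rewrite /= addn1.
- exists (inl (inr (Ordinal (odd_spoke x)))); first by rewrite /pent_edge /=; lia.
  by rewrite /= addn1.
- have {}xy : x != y by apply: contraNneq xy => ->.
  exists (inl (inl (Ordinal (odd_spoke x)))); first by rewrite /pent_edge /=; lia.
  by rewrite /= xy; lia.
Qed.

Lemma pent_gdist n (x y : pentagonal_cylinder n) : gdist x y = pent_dist x y.
Proof.
apply: (@gdist_potential _ y (fun x => pent_dist x y)).
- by case: y => [[]|] y /=; rewrite ?eqxx /cycle_dist; lia.
- by move=> u v uv; apply: pent_dist_lip.
- by move=> u uy; apply: pent_dist_descent.
Qed.

(** * Degrees *)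

Lemma pent_eqE n (x y : pentagonal_cylinder n) :
  (x == y) = match x, y with
    | inl (inl i), inl (inl j) | inl (inr i), inl (inr j) => i == j :> nat
    | inr k, inr l => k == l :> nat
    | _, _ => false
    end.
Proof. by case: x y => [[]|] x [[]|] y. Qed.

(** For [1 < n] the cycles have length at least 4, so the two cycle neighbours of a vertex are
    distinct. *)
Lemma pent_deg n (x : pentagonal_cylinder n) : 1 < n ->
  deg x = if x is inl _ then 3 else 2.
Proof.
move=> n1.
have next_lt (i : 'I_(2 * n)) : (if i.+1 == 2 * n then 0 else i.+1) < 2 * n.
  by have := ltn_ord i; case: ifP; lia.
have prev_lt (i : 'I_(2 * n)) : (if i == 0 :> nat then (2 * n).-1 else i.-1) < 2 * n.
  by have := ltn_ord i; case: ifP; lia.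
have half_lt (i : 'I_(2 * n)) : i./2 < n by have := ltn_ord i; lia.
have odd_spoke (k : 'I_n) : (2 * k).+1 < 2 * n by have := ltn_ord k; lia.
have [next nextE] : {f : 'I_(2 * n) -> 'I_(2 * n) |
    forall i, f i = (if i.+1 == 2 * n then 0 else i.+1) :> nat}.
  by exists (fun i => Ordinal (next_lt i)).
have [prev prevE] : {f : 'I_(2 * n) -> 'I_(2 * n) |
    forall i, f i = (if i == 0 :> nat then (2 * n).-1 else i.-1) :> nat}.
  by exists (fun i => Ordinal (prev_lt i)).
(* [f] embeds the indices into the vertex's own cycle, [g] into the opposite one. *)
pose nbrs (f g : 'I_(2 * n) -> pentagonal_cylinder n) i : seq (pentagonal_cylinder n) :=
  [:: f (next i); f (prev i);
      if odd i then inr (Ordinal (half_lt i)) else g i].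
case: x => [[]|] i; have := ltn_ord i.
- rewrite (@deg_uniq_seq _ _ (nbrs (inl \o inl) (inl \o inr) i)) //.
    rewrite /nbrs /= !inE; case: (odd i); rewrite !pent_eqE /= nextE ?prevE;
    by do 2! case: ifP; lia.
  by case=> [[]|] j; rewrite /nbrs !inE; case: ifP => oi;
    rewrite !pent_eqE /= /pent_edge /= /cycle_arc -?val_eqE /= ?nextE ?prevE;
    have := ltn_ord j; do 2? case: ifP; lia.
- rewrite (@deg_uniq_seq _ _ (nbrs (inl \o inr) (inl \o inl) i)) //.
    rewrite /nbrs /= !inE; case: (odd i); rewrite !pent_eqE /= nextE ?prevE;
    by do 2! case: ifP; lia.
  by case=> [[]|] j; rewrite /nbrs !inE; case: ifP => oi;
    rewrite !pent_eqE /= /pent_edge /= /cycle_arc -?val_eqE /= ?nextE ?prevE;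
    have := ltn_ord j; do 2? case: ifP; lia.
- pose s : seq (pentagonal_cylinder n) :=
    [:: inl (inl (Ordinal (odd_spoke i))); inl (inr (Ordinal (odd_spoke i)))].
  rewrite (@deg_uniq_seq _ _ s) // => -[[]|] j;
    rewrite !inE !pent_eqE /= /pent_edge /=; lia.
Qed.

(** * Summation over all pairs *)

Lemma sum_odd n : \sum_(i < 2 * n) odd i = n.
Proof.
elim: n => [|n IH]; first by rewrite big_ord0.
have -> : 2 * n.+1 = (2 * n).+2 by lia.
by rewrite !big_ord_recr /= IH oddM /=; lia.
Qed.

Lemma pent_gutman_sum n : 1 < n ->
  \sum_(x : pentagonal_cylinder n) \sum_(y : pentagonal_cylinder n)
    deg x * deg y * gdist x y =
  96 * n ^ 3 + 128 * n ^ 2 + 10 * n + 8 * n * (n ^ 2 %/ 4).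
Proof.
move=> n1; pose w (x : pent_vertex n) := if x is inl _ then 3 else 2.
transitivity (\sum_x \sum_y w x * w y * pent_dist x y).
  by do 2! apply: eq_bigr => ? _; rewrite pent_gdist !pent_deg.
have sumM m c (F : 'I_m -> nat) : \sum_(j < m) c * F j = c * \sum_(j < m) F j.
  by rewrite big_distrr.
have sumC m c : \sum_(j < m) c = m * c by rewrite sum_nat_const card_ord.
have odd_spoke (k : 'I_n) : (2 * k).+1 < 2 * n by have := ltn_ord k; lia.
have sum_cycle i : i < 2 * n -> \sum_(j < 2 * n) cycle_dist (2 * n) i j = n ^ 2.
  by move=> i_lt; rewrite cycle_dist_sum //; lia.
have sum_diag m (i : 'I_m) : \sum_(j < m) (i == j) = 1.
  by rewrite (bigD1 i) //= eqxx big1 // => j; rewrite eq_sym => /negPf ->.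
have sum_spokes (k : 'I_n) :
    \sum_(l < n) cycle_dist (2 * n) (2 * k).+1 (2 * l).+1 = 2 * (n ^ 2 %/ 4).
  rewrite -(cycle_dist_sum (ltn_ord k)) big_distrr /=.
  by apply: eq_bigr => l _; rewrite cycle_dist_double.
have row_w k : \sum_y w (inr k) * w y * pent_dist (inr k) y =
    12 * n ^ 2 + 24 * n + 8 * (n ^ 2 %/ 4) + 8 * n.-1.
  rewrite !big_sumType /= !sumM 2!big_split /= !sum_cycle // !sumC.
  rewrite sum_spokes sumM /=.
  (* The correction between distinct w's is counted by complement, which gives the [n.-1]. *)
  have : \sum_(l < n) (k == l) + \sum_(l < n) (k != l) = n.
    rewrite -big_split -[RHS]muln1 -sumC; apply: eq_bigr => l _ /=.
    by case: (k == l).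
  rewrite sum_diag.
  by move: (\sum_(l < n) _) (n ^ 2 %/ 4) (n ^ 2) => a b c; lia.
(* The sum over the w's depends on the parity of [i], so it stays unevaluated here. *)
have row_u i (x := inl (inl i) : pent_vertex n) (x' := inl (inr i) : pent_vertex n) :
    \sum_y w x * w y * pent_dist x y + \sum_y w x' * w y * pent_dist x' y =
    36 * n ^ 2 + 48 * n + 18 * odd i
    + 12 * \sum_(k < n) cycle_dist (2 * n) (2 * k).+1 i.
  have rung : \sum_(j < 2 * n) ((i == j) && odd i) = odd i.
    case: (odd i); last by rewrite big1 // => j _; rewrite andbF.
    by rewrite -[RHS](sum_diag _ i); apply: eq_bigr => j _; rewrite andbT.
  have spokesC : \sum_(k < n) cycle_dist (2 * n) i (2 * k).+1 =
      \sum_(k < n) cycle_dist (2 * n) (2 * k).+1 i.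
    by apply: eq_bigr => k _; rewrite /cycle_dist addnC.
  rewrite !big_sumType /= !sumM !big_split /= !sum_cycle // !sumC.
  rewrite rung spokesC.
  by move: (\sum_(k < n) _) (n ^ 2) => a b; lia.
rewrite !big_sumType /= -big_split /=.
rewrite (eq_bigr _ (fun i _ => row_u i)) [X in _ + X](eq_bigr _ (fun i _ => row_w i)).
(* After the exchange, the inner sum runs over the full cycle from a fixed w position, and is
   [n ^ 2] whatever the parity. *)
rewrite !big_split /= !sumM /= sum_odd !sumC exchange_big /=.
rewrite (eq_bigr (fun=> n ^ 2)) => [|k _]; last exact: sum_cycle.
rewrite sumC; case: n n1 {w sumC sumM odd_spoke sum_cycle sum_spokes row_w row_u sum_diag} => // n _.
by rewrite !expnS expn0 /=; ring.
Qed.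

Theorem theorem8 (n : nat) (hn : 2 <= n) :
  gutman (pentagonal_cylinder n) =
    (if odd n then 49 * n%:R ^+ 3 + 64 * n%:R ^+ 2 + 4 * n%:R
     else 49 * n%:R ^+ 3 + 64 * n%:R ^+ 2 + 5 * n%:R)%R.
Proof.
have -> : gutman (pentagonal_cylinder n) = (2^-1 *
    (\sum_(x : pentagonal_cylinder n) \sum_(y : pentagonal_cylinder n)
      deg x * deg y * gdist x y)%N%:R)%R.
  rewrite /gutman GRing.natr_sum; congr (_ * _)%R.
  by apply: eq_bigr => x _; rewrite GRing.natr_sum.
rewrite pent_gutman_sum //.
(* Multiplied by [n], this removes the floor: the linear coefficient 10 stays for even [n] and drops
   to 8 for odd [n]. *)
have four : 8 * (n ^ 2 %/ 4) + 2 * odd n = 2 * n ^ 2.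
  by rewrite -(odd_double_half n); case: (odd n); rewrite /=; lia.
have -> : 96 * n ^ 3 + 128 * n ^ 2 + 10 * n + 8 * n * (n ^ 2 %/ 4) =
    2 * (49 * n ^ 3 + 64 * n ^ 2 + (if odd n then 4 else 5) * n).
  by case: (odd n) four => /=; nia.
by case: (odd n); rewrite !(GRing.natrM, GRing.natrD, GRing.natrX); field.
Qed.
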